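(* Let $\mathbb{Z}_2=\{0,1\}=\mathbb{Z}/2\mathbb{Z}$ and let $D_2$ be the Dyck shift over the alphabet $\{\alpha_1,\alpha_2\}\cup\{\beta_1,\beta_2\}$. Define $\ell^1,\ell^2:\{\alpha_1,\alpha_2\}\cup\{\beta_1,\beta_2\}\to\mathbb{Z}_2$ by $$\ell^1(\alpha_1)=\ell^1(\alpha_2)=\ell^1(\beta_1)=\ell^1(\beta_2)=0,$$ $$\ell^2(\alpha_1)=1,\quad \ell^2(\alpha_2)=0,\quad \ell^2(\beta_1)=1,\quad \ell^2(\beta_2)=0,$$ and let $\tau_{\ell^i}:D_2\to\mathbb{Z}_2$, $\tau_{\ell^i}((x_n)_{n\in\mathbb{Z}})=\ell^i(x_0)$, be the associated skewing functions. Then the $G$-subshifts $D_2^{\mathbb{Z}_2,\tau_{\ell^1}}$ and $D_2^{\mathbb{Z}_2,\tau_{\ell^2}}$ are not $G$-conjugate for $G=\mathbb{Z}_2$.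
   Context: Dyck shift $D_2$: consider the monoid with zero generated by $\alpha_1,\alpha_2,\beta_1,\beta_2$ with relations $\alpha_i\beta_j=\mathbf{1}$ if $i=j$ and $\alpha_i\beta_j=0$ if $i\ne j$. $D_2$ is the subshift over $\{\alpha_1,\alpha_2,\beta_1,\beta_2\}$ in which a word $\omega_1\cdots\omega_n$ is admissible precisely if the product $\omega_1\cdots\omega_n$ is nonzero in this monoid. Skew products: for a finite group $G$, a subshift $(\Lambda,\sigma)$ and a continuous $\tau:\Lambda\to G$, $\Lambda^{G,\tau}$ is $G\times\Lambda$ with the homeomorphism $(g,x)\mapsto(g\tau(x),\sigma(x))$ and the $G$-action $\rho_g(a,x)=(ga,x)$; it is (topologically conjugate to) a subshift with a $G$-action commuting with the shift (a $G$-subshift). Two $G$-subshifts are $G$-conjugate if there is a topological conjugacy between them commuting with the $G$-actions. *)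

(* Defs.v *)
From HB Require Import structures.
From mathcomp Require Import all_boot all_order all_algebra all_fingroup.
From mathcomp Require Import all_classical.
From mathcomp Require Import topology.

Set Implicit Arguments.
Unset Strict Implicit.
Unset Printing Implicit Defensive.

Import GRing.Theory.
Local Open Scope classical_set_scope.
Local Open Scope ring_scope.

Definition homeomorphism (X Y : topologicalType) (f : X -> Y) : Prop :=
  continuous f /\
  exists g : Y -> X, [/\ continuous g, cancel f g & cancel g f].

Definition full_shift (A : finType) : topologicalType :=
  {ptws int -> discrete_topology A}.

Definition shift (A : finType) (x : full_shift A) : full_shift A :=
  fun n => x (n + 1).

Definition unshift (A : finType) (x : full_shift A) : full_shift A :=
  fun n => x (n - 1).

Lemma shiftK (A : finType) : cancel (@shift A) (@unshift A).
Proof. by move=> x; apply/funext => n; rewrite /unshift /shift subrK. Qed.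

Lemma unshiftK (A : finType) : cancel (@unshift A) (@shift A).
Proof. by move=> x; apply/funext => n; rewrite /unshift /shift addrK. Qed.

Record subshift (A : finType) := Subshift {
  subshift_set :> set (full_shift A);
  subshift_closed : closed subshift_set;
  subshift_inv : @shift A @` subshift_set = subshift_set }.

Definition points (A : finType) (L : subshift A) : topologicalType :=
  set_type (subshift_set L).

Section SubshiftMap.
Variables (A : finType) (L : subshift A).

Lemma shift_mem (x : full_shift A) : subshift_set L x -> subshift_set L (shift x).
Proof. by move=> Lx; rewrite -(subshift_inv L); exists x. Qed.

Lemma unshift_mem (x : full_shift A) :
  subshift_set L x -> subshift_set L (unshift x).
Proof.
by rewrite -{1}(subshift_inv L) => -[y Ly <-]; rewrite shiftK.
Qed.

Definition sigma (x : points L) : points L :=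
  exist _ (shift (\val x)) (mem_set (shift_mem (set_mem (valP x)))).

Definition sigma_inv (x : points L) : points L :=
  exist _ (unshift (\val x)) (mem_set (unshift_mem (set_mem (valP x)))).

Lemma sigmaK : cancel sigma sigma_inv.
Proof. by move=> x; apply/val_inj => /=; rewrite shiftK. Qed.

Lemma sigma_invK : cancel sigma_inv sigma.
Proof. by move=> x; apply/val_inj => /=; rewrite unshiftK. Qed.

Lemma coord_continuous (n : int) :
  continuous (fun x : full_shift A => x n : discrete_topology A).
Proof. exact: (@proj_continuous int (fun=> discrete_topology A)). Qed.

Lemma points_coord_continuous (n : int) :
  continuous (fun x : points L => (\val x) n : discrete_topology A).
Proof.
move=> x; apply: (@continuous_comp _ _ _ (fun y : points L => \val y)
  (fun y : full_shift A => y n : discrete_topology A)).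
  exact: initial_continuous.
exact: coord_continuous.
Qed.

Lemma to_points_continuous (X : topologicalType) (f : X -> points L) :
  (forall n, continuous (fun x => (\val (f x)) n : discrete_topology A)) ->
  continuous f.
Proof.
move=> cf; apply: continuous_comp_initial => x.
apply/cvg_sup => n.
by have := @continuous_comp_initial _ _ _
  (fun y : forall _ : int, discrete_topology A => y n)
  (fun x => \val (f x)) (cf n); apply.
Qed.

Lemma sigma_continuous : continuous sigma.
Proof.
by apply: to_points_continuous => n; exact: points_coord_continuous.
Qed.

Lemma sigma_inv_continuous : continuous sigma_inv.
Proof.
by apply: to_points_continuous => n; exact: points_coord_continuous.
Qed.

End SubshiftMap.

Definition factor (A : finType) (x : full_shift A) (m : int) (n : nat) : seq A :=
  mkseq (fun i => x (m + i%:Z)) n.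

Definition language_shift_set (A : finType) (W : seq A -> Prop) :
  set (full_shift A) := [set x | forall m n, W (factor x m n)].

Lemma language_shift_closed (A : finType) (W : seq A -> Prop) :
  closed (language_shift_set W).
Proof.
have -> : language_shift_set W = \bigcap_m \bigcap_n [set x | W (factor x m n)].
  by apply/seteqP; split=> x /= Wx m; [move=> _ n _|move=> n]; apply: Wx.
apply: closed_bigI => m _; apply: closed_bigI => n _.
rewrite -[X in closed X]setCK closedC openE => x /= nWx.
have coord i : nbhs x [set y : full_shift A | y i = x i].
  apply: (@coord_continuous A i x [set x i]).
  exact: (@discrete_set1 (discrete_topology A)).
have : nbhs x [set y | factor y m n = factor x m n].
  rewrite /factor; elim: n {nWx} => [|n IHn]; first by apply: filterE => y.
  near=> y; rewrite /= !mkseqS; congr rcons; last first.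
    by near: y; exact: coord.
  by near: y; exact: IHn.
by apply: filterS => y /= ->.
Unshelve. all: by end_near. Qed.

Lemma language_shift_inv (A : finType) (W : seq A -> Prop) :
  @shift A @` language_shift_set W = language_shift_set W.
Proof.
have E d (x : full_shift A) m n : factor (fun k => x (k + d)) m n =
    factor x (m + d) n.
  by apply: eq_map => i; rewrite addrAC.
apply/seteqP; split=> [_ [x Wx <-] m n|x Wx].
  by rewrite /shift E; apply: Wx.
exists (unshift x); last exact: unshiftK.
by move=> m n; rewrite /unshift E; apply: Wx.
Qed.

Definition language_shift (A : finType) (W : seq A -> Prop) : subshift A :=
  Subshift (@language_shift_closed A W) (language_shift_inv W).

(* A G-subshift is an instance of this structure; the skew product is kept as a
   system on G * L instead of being recoded over another alphabet, which
   G-conjugacy does not see. *)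
Record G_system (G : finGroupType) := GSystem {
  gs_space : topologicalType;
  gs_map : gs_space -> gs_space;
  gs_act : G -> gs_space -> gs_space;
  gs_map_homeo : homeomorphism gs_map;
  gs_act_continuous : forall g, continuous (gs_act g);
  gs_act1 : forall x, gs_act 1%g x = x;
  gs_actM : forall g h x, gs_act (g * h)%g x = gs_act g (gs_act h x);
  gs_map_act : forall g x, gs_map (gs_act g x) = gs_act g (gs_map x) }.

Definition G_conjugate (G : finGroupType) (S T : G_system G) : Prop :=
  exists phi : gs_space S -> gs_space T,
    [/\ homeomorphism phi,
        forall x, phi (gs_map x) = gs_map (phi x) &
        forall g x, phi (gs_act g x) = gs_act g (phi x)].

Section SkewProduct.
Variables (G : finGroupType) (A : finType) (L : subshift A).
Variable tau : points L -> discrete_topology G.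
Hypothesis tau_continuous : continuous tau.

Definition skew_space : topologicalType :=
  (discrete_topology G * points L)%type.

Definition skew_map (p : skew_space) : skew_space :=
  ((p.1 : G) * tau p.2, sigma p.2)%g.

Definition skew_act (g : G) (p : skew_space) : skew_space :=
  (g * p.1, p.2)%g.

Lemma mulg_discrete_continuous (X : topologicalType)
    (f h : X -> discrete_topology G) :
  continuous f -> continuous h ->
  continuous (fun x => ((f x : G) * h x)%g : discrete_topology G).
Proof.
move=> cf ch x; apply/discrete_cvg.
have /discrete_cvg fx := cf x.
have /discrete_cvg hx := ch x.
have fx' : nbhs x [set y | f y = f x] := fx.
have hx' : nbhs x [set y | h y = h x] := hx.
suff : nbhs x [set y | (f y * h y)%g = (f x * h x)%g] by [].
by apply: filterS2 fx' hx' => y /= -> ->.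
Qed.

Lemma invg_discrete_continuous (X : topologicalType)
    (f : X -> discrete_topology G) :
  continuous f -> continuous (fun x => ((f x : G)^-1)%g : discrete_topology G).
Proof.
move=> cf x; apply/discrete_cvg.
have /discrete_cvg fx := cf x.
have fx' : nbhs x [set y | f y = f x] := fx.
suff : nbhs x [set y | (f y : G)^-1%g = (f x : G)^-1%g] by [].
by apply: filterS fx' => y /= ->.
Qed.

Lemma skew_pair_continuous (X : topologicalType)
    (f : X -> discrete_topology G) (h : X -> points L) :
  continuous f -> continuous h ->
  continuous (fun x => (f x, h x) : skew_space).
Proof. by move=> cf ch x; exact: (cvg_pair (cf x) (ch x)). Qed.

Lemma skew_fst_continuous :
  continuous (fun p : skew_space => p.1 : discrete_topology G).
Proof. by move=> p; exact: cvg_fst. Qed.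

Lemma skew_snd_continuous : continuous (fun p : skew_space => p.2 : points L).
Proof. by move=> p; exact: cvg_snd. Qed.

Lemma skew_map_homeo : homeomorphism skew_map.
Proof.
split.
  apply: skew_pair_continuous.
    apply: mulg_discrete_continuous; first exact: skew_fst_continuous.
    move=> p; apply: continuous_comp; first exact: skew_snd_continuous.
    exact: tau_continuous.
  move=> p; apply: continuous_comp; first exact: skew_snd_continuous.
  exact: sigma_continuous.
exists (fun p : skew_space =>
  ((p.1 : G) * (tau (sigma_inv p.2) : G)^-1, sigma_inv p.2)%g : skew_space).
split.
- apply: skew_pair_continuous.
    apply: mulg_discrete_continuous; first exact: skew_fst_continuous.
    apply: invg_discrete_continuous => p.
    apply: (@continuous_comp _ _ _ (fun q : skew_space => sigma_inv q.2) tau);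
      last exact: tau_continuous.
    apply: continuous_comp; first exact: skew_snd_continuous.
    exact: sigma_inv_continuous.
  move=> p; apply: continuous_comp; first exact: skew_snd_continuous.
  exact: sigma_inv_continuous.
- by move=> [g x]; rewrite /skew_map /= sigmaK mulgK.
- by move=> [g x]; rewrite /skew_map /= sigma_invK mulgKV.
Qed.

Lemma skew_act_continuous g : continuous (skew_act g).
Proof.
apply: skew_pair_continuous; last exact: skew_snd_continuous.
apply: mulg_discrete_continuous; last exact: skew_fst_continuous.
by move=> p; exact: cvg_cst.
Qed.

Lemma skew_act1 p : skew_act 1%g p = p.
Proof. by case: p => g x; rewrite /skew_act /= mul1g. Qed.

Lemma skew_actM g h p : skew_act (g * h)%g p = skew_act g (skew_act h p).
Proof. by rewrite /skew_act /= mulgA. Qed.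

Lemma skew_map_act g p : skew_map (skew_act g p) = skew_act g (skew_map p).
Proof. by rewrite /skew_act /skew_map /= mulgA. Qed.

Definition skew_product : G_system G :=
  GSystem skew_map_homeo skew_act_continuous skew_act1 skew_actM skew_map_act.

End SkewProduct.

Arguments skew_product {G A L} tau tau_continuous.

Definition tau_of (G : finGroupType) (A : finType) (L : subshift A) (l : A -> G)
  (x : points L) : discrete_topology G := l ((\val x) 0).

Arguments tau_of {G A} L l x.

Lemma tau_of_continuous (G : finGroupType) (A : finType) (L : subshift A)
  (l : A -> G) : continuous (tau_of L l).
Proof.
move=> x U /principal_filterP Ux.
have : nbhs x [set y : points L | (\val y) 0 = (\val x) 0].
  apply: (@points_coord_continuous A L 0 x [set (\val x) 0]).
  exact: (@discrete_set1 (discrete_topology A)).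
apply: filterS => y yx.
have ty : tau_of L l y = tau_of L l x := congr1 l yx.
by change (U (tau_of L l y)); rewrite ty.
Qed.

Arguments tau_of_continuous {G A} L l.

(* Monoids with zero given by generators and relations: [Some w] is the product
   of the word [w] ([Some [::]] is the identity), [None] is the zero. *)

Definition mulw0 (A : Type) (u v : option (seq A)) : option (seq A) :=
  if u is Some s then if v is Some t then Some (s ++ t) else None else None.

Inductive presented_eq (A : Type) (R : option (seq A) -> option (seq A) -> Prop) :
  option (seq A) -> option (seq A) -> Prop :=
| presented_rel u v of R u v : presented_eq R u v
| presented_refl u : presented_eq R u u
| presented_sym u v of presented_eq R u v : presented_eq R v u
| presented_trans u v w of presented_eq R u v & presented_eq R v w :
    presented_eq R u w
| presented_mul u u' v v' of presented_eq R u u' & presented_eq R v v' :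
    presented_eq R (mulw0 u v) (mulw0 u' v').

(* Indices are 0-based: the elements 0 and 1 of 'I_2 stand
   for the subscripts 1 and 2. *)

Inductive dyck_letter := alpha of 'I_2 | beta of 'I_2.

Definition dyck_letter_encode (a : dyck_letter) : 'I_2 + 'I_2 :=
  match a with alpha i => inl i | beta i => inr i end.

Definition dyck_letter_decode (s : 'I_2 + 'I_2) : dyck_letter :=
  match s with inl i => alpha i | inr i => beta i end.

Lemma dyck_letter_encodeK : cancel dyck_letter_encode dyck_letter_decode.
Proof. by case. Qed.

HB.instance Definition _ := Finite.copy dyck_letter (can_type dyck_letter_encodeK).

Inductive dyck_rel : option (seq dyck_letter) -> option (seq dyck_letter) -> Prop :=
| dyck_rel1 i : dyck_rel (Some [:: alpha i; beta i]) (Some [::])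
| dyck_rel0 i j of i != j : dyck_rel (Some [:: alpha i; beta j]) None.

Definition dyck_admissible (w : seq dyck_letter) : Prop :=
  ~ presented_eq dyck_rel (Some w) None.

Definition D2 : subshift dyck_letter := language_shift dyck_admissible.

Definition ell1 (a : dyck_letter) : 'Z_2 := 0.

Definition ell2 (a : dyck_letter) : 'Z_2 :=
  match a with
  | alpha i | beta i => if i == 0 then 1 else 0
  end.

(* Main.v *)
Require Import Defs.
From mathcomp Require Import all_boot all_order all_algebra all_fingroup.
From mathcomp Require Import all_classical.
From mathcomp Require Import topology.

(** Let y be the fixed point of D_2 all of whose letters are alpha_1.  Since
    ell^2(alpha_1) = 1, the skew map of ell^2 acts on (0, y) as the nontrivial
    group element.  A G-conjugacy would yield a point of the skew product of
    ell^1 with the same property, but ell^1 = 0, so that skew map fixes the group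
    coordinate. *)

(* Right action of the letters on stacks: [alpha i] pushes [i], [beta j] pops
   [j] and kills every other stack. *)
Definition dyck_step (s : option (seq 'I_2)) (a : dyck_letter) :
    option (seq 'I_2) :=
  match a, s with
  | alpha i, Some t => Some (i :: t)
  | beta j, Some (i :: t) => if i == j then Some t else None
  | _, _ => None
  end.

Definition dyck_eval (u : option (seq dyck_letter)) (s : option (seq 'I_2)) :
    option (seq 'I_2) :=
  if u is Some w then foldl dyck_step s w else None.

Lemma dyck_eval_dead u : dyck_eval u None = None.
Proof. by case: u => //=; elim=> [|[i|i] w IHw]. Qed.

Lemma dyck_eval_mul u v s :
  dyck_eval (mulw0 u v) s = dyck_eval v (dyck_eval u s).
Proof.
case: u => [u|] /=; last by rewrite dyck_eval_dead.
by case: v => [v|] //=; rewrite foldl_cat.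
Qed.

(** The stack action respects the defining relations, so a word that keeps some stack alive is
    nonzero in the monoid. *)
Lemma dyck_eval_presented u v :
  presented_eq dyck_rel u v -> dyck_eval u =1 dyck_eval v.
Proof.
elim=> {u v} [u v [i|i j /negPf ij]|u|u v _ IH|u v w _ IH1 _ IH2
  |u u' v v' _ IHu _ IHv] s //=.
- by case: s => //= t; rewrite eqxx.
- by case: s => //= t; rewrite ij.
- by rewrite IH1.
- by rewrite !dyck_eval_mul IHu IHv.
Qed.

Lemma alpha_word_admissible (w : seq dyck_letter) (i : 'I_2) :
  all (pred1 (alpha i)) w -> dyck_admissible w.
Proof.
move=> wi /dyck_eval_presented/(_ (Some [::])) /=.
(* A push never kills a stack; the stack is generalized because each push makes it grow. *)
elim: w [::] wi => [|a w IHw] t //= /andP[/eqP-> wi].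
exact: IHw.
Qed.

Lemma D2_alpha (i : 'I_2) : subshift_set D2 (fun=> alpha i).
Proof.
move=> m n; apply: (@alpha_word_admissible _ i).
by apply/allP => a /mapP[k _ ->]; rewrite /= eqxx.
Qed.

Theorem proposition7p7 :
  ~ @G_conjugate 'Z_2
      (skew_product (tau_of D2 ell1) (tau_of_continuous D2 ell1))
      (skew_product (tau_of D2 ell2) (tau_of_continuous D2 ell2)).
Proof.
case=> phi [[_ [psi [_ phiK psiK]]] phi_map phi_act].
pose y : points D2 := exist _ (fun=> alpha ord0) (mem_set (D2_alpha ord0)).
pose p : skew_space 'Z_2 D2 := (1%g, y).
have p_map : skew_map (tau_of D2 ell2) p = skew_act (ell2 (alpha ord0)) p.
  by congr pair; exact: val_inj.
have psi_p_map : skew_map (tau_of D2 ell1) (psi p) =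
    skew_act (ell2 (alpha ord0)) (psi p).
  by apply: (can_inj phiK); rewrite phi_map phi_act psiK.
have /(congr1 fst) /= := psi_p_map.
(* The group coordinate g of [psi p] would satisfy g + 0 = 1 + g, which fails for both values of g
   in ['Z_2]. *)
by case: (psi p) => [[[|[|//]] lt_g] x] /(congr1 val).
Qed.
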